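(* Let $A_1\in\mathbb{R}_{+}^{m_1\times n_1}$ and $A_2\in\mathbb{R}_{+}^{m_2\times n_2}$ be such that at least one of them has rank $1$. Then $$\operatorname{rk}_{+}(A_1\otimes A_2)=\operatorname{rk}_{+}(A_1)\operatorname{rk}_{+}(A_2).$$
   Context: Here $\mathbb{R}_{+}^{m\times n}$ is the set of $m\times n$ real matrices with nonnegative entries, and $\otimes$ is the Kronecker product. For $A\in\mathbb{R}_{+}^{m\times n}$, the nonnegative rank $\operatorname{rk}_{+}(A)$ is the smallest integer $k$ such that $A=UV^{T}$ for some $U\in\mathbb{R}_{+}^{m\times k}$ and $V\in\mathbb{R}_{+}^{n\times k}$, with the convention $\operatorname{rk}_{+}(0)=0$. *)

(* Defs.v *)
From mathcomp Require Import all_boot all_order all_algebra.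
From mathcomp Require Import mxtens boolp reals.
Set Implicit Arguments.
Unset Strict Implicit.
Unset Printing Implicit Defensive.
Import Order.TTheory GRing.Theory Num.Theory.
Local Open Scope ring_scope.

Definition nonneg_mx (R : realType) (m n : nat) (A : 'M[R]_(m, n)) : Prop :=
  forall i j, 0 <= A i j.

Definition nonneg_factorable (R : realType) (m n : nat) (A : 'M[R]_(m, n))
    (k : nat) : Prop :=
  exists (U : 'M[R]_(m, k)) (V : 'M[R]_(n, k)),
    [/\ nonneg_mx U, nonneg_mx V & A = U *m V^T].

Lemma nonneg_factorable_exists (R : realType) (m n : nat) (A : 'M[R]_(m, n)) :
  nonneg_mx A -> exists k, `[< nonneg_factorable A k >].
Proof.
move=> A_ge0; exists n; apply/asboolP; exists A, 1%:M; split => //.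
- by move=> i j; rewrite mxE ler0n.
- by rewrite trmx1 mulmx1.
Qed.

(* The value 0 in the last branch is a default, which by
   [nonneg_factorable_exists] is never taken for a nonnegative matrix. *)
Definition nonneg_rank (R : realType) (m n : nat) (A : 'M[R]_(m, n)) : nat :=
  if pselect (exists k, `[< nonneg_factorable A k >]) is left ex_k
  then ex_minn ex_k else 0%N.

Lemma nonneg_rankP (R : realType) (m n : nat) (A : 'M[R]_(m, n)) :
  nonneg_mx A ->
  nonneg_factorable A (nonneg_rank A) /\
  forall k, nonneg_factorable A k -> (nonneg_rank A <= k)%N.
Proof.
move=> /nonneg_factorable_exists ex_k; rewrite /nonneg_rank.
case: pselect => // {}ex_k; case: ex_minnP => k /asboolP Ak k_min.
by split=> // l /asboolP /k_min.
Qed.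

Lemma nonneg_rank0 (R : realType) (m n : nat) :
  nonneg_rank (0 : 'M[R]_(m, n)) = 0%N.
Proof.
have A_ge0 : nonneg_mx (0 : 'M[R]_(m, n)) by move=> i j; rewrite mxE.
have [_ le_rk] := nonneg_rankP A_ge0.
apply/eqP; rewrite -leqn0; apply: le_rk; exists 0, 0.
by split; rewrite ?mul0mx // => i [].
Qed.

(* Main.v *)
(** Submatrices and nonnegative multiples of A have nonnegative rank at most that
    of A, and a positive entry of one factor of A (x) B exhibits a positive
    multiple of the other factor as a submatrix. A nonnegative matrix of rank 1
    has nonnegative rank 1, its factorization being the column and the row
    through a positive entry, so when one factor has rank 1 these bounds meet
    submultiplicativity, which holds because a Kronecker product of
    factorizations is a factorization. *)
Require Import Defs.
From mathcomp Require Import all_boot all_order all_algebra.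
From mathcomp Require Import mxtens boolp reals.
Import Order.TTheory GRing.Theory Num.Theory.
Local Open Scope ring_scope.

Section NonnegRank.
Set Implicit Arguments.
Unset Strict Implicit.
Context {R : realType}.

Lemma nonneg_mx_mxsub m n p q (f : 'I_p -> 'I_m) (g : 'I_q -> 'I_n)
  (A : 'M[R]_(m, n)) : nonneg_mx A -> nonneg_mx (mxsub f g A).
Proof. by move=> A_ge0 i j; rewrite mxE. Qed.

Lemma nonneg_mx_scale m n (c : R) (A : 'M[R]_(m, n)) :
  0 <= c -> nonneg_mx A -> nonneg_mx (c *: A).
Proof. by move=> c_ge0 A_ge0 i j; rewrite mxE mulr_ge0. Qed.

Lemma nonneg_mx_tens m1 n1 m2 n2 (A : 'M[R]_(m1, n1)) (B : 'M[R]_(m2, n2)) :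
  nonneg_mx A -> nonneg_mx B -> nonneg_mx (A *t B).
Proof. by move=> A_ge0 B_ge0 i j; rewrite mxE mulr_ge0. Qed.

Lemma nonneg_factorable_mxsub m n p q (f : 'I_p -> 'I_m) (g : 'I_q -> 'I_n)
  (A : 'M[R]_(m, n)) k :
  nonneg_factorable A k -> nonneg_factorable (mxsub f g A) k.
Proof.
move=> [U [V [U_ge0 V_ge0 ->]]]; exists (rowsub f U), (rowsub g V).
by split; [exact: nonneg_mx_mxsub.. | rewrite mxsub_mul trmx_mxsub].
Qed.

Lemma nonneg_factorable_scale m n (c : R) (A : 'M[R]_(m, n)) k :
  0 <= c -> nonneg_factorable A k -> nonneg_factorable (c *: A) k.
Proof.
move=> c_ge0 [U [V [U_ge0 V_ge0 ->]]]; exists (c *: U), V.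
by split => //; [exact: nonneg_mx_scale | rewrite scalemxAl].
Qed.

(** By the mixed-product rule, the product of [U *t W] and [(V *t X)^T] is the tensor of the two
    given products. *)
Lemma nonneg_factorable_tens m1 n1 m2 n2 (A : 'M[R]_(m1, n1))
  (B : 'M[R]_(m2, n2)) k l :
  nonneg_factorable A k -> nonneg_factorable B l ->
  nonneg_factorable (A *t B) (k * l).
Proof.
move=> [U [V [U_ge0 V_ge0 ->]]] [W [X [W_ge0 X_ge0 ->]]].
exists (U *t W), (V *t X); split; [exact: nonneg_mx_tens.. |].
by rewrite trmx_tens tensmx_mul.
Qed.

Lemma mxrank_nonneg_factorable m n (A : 'M[R]_(m, n)) k :
  nonneg_factorable A k -> (\rank A <= k)%N.
Proof. by move=> [U [V [_ _ ->]]]; exact: mulmx_max_rank. Qed.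

Lemma mxrank1_minor m n (A : 'M[R]_(m, n)) i j p q :
  \rank A = 1%N -> A p q * A i j = A p j * A i q.
Proof.
move=> A_rank1; rewrite -(mulmx_base A).
(* The inner dimension of the bases is [\rank A], so they are generalized before it becomes 1. Each
   entry of [A] is then a single product of an entry of [C] and one of [D]. *)
move: (col_base A) (row_base A); rewrite A_rank1 => C D.
by rewrite !mxE !big_ord1 mulrACA [D _ q * _]mulrC mulrACA.
Qed.

Lemma nonneg_mx_neq0 m n (A : 'M[R]_(m, n)) :
  nonneg_mx A -> A != 0 -> exists i j, 0 < A i j.
Proof.
move=> A_ge0 /matrix0Pn [i [j Aij_neq0]]; exists i, j.
by rewrite lt0r Aij_neq0 A_ge0.
Qed.

Lemma nonneg_rank_rank1 m n (A : 'M[R]_(m, n)) :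
  nonneg_mx A -> \rank A = 1%N -> nonneg_rank A = 1%N.
Proof.
move=> A_ge0 A_rank1; have [A_fact A_min] := nonneg_rankP A_ge0.
(* The lower bound is the ordinary rank; a factorization of inner size 1 remains to be found. *)
apply/eqP; rewrite eqn_leq -{2}A_rank1 mxrank_nonneg_factorable // andbT.
have A_neq0 : A != 0 by rewrite -mxrank_eq0 A_rank1.
have [i [j Aij_gt0]] := nonneg_mx_neq0 A_ge0 A_neq0.
(* Dividing by the pivot [A i j] makes the outer product exact, by the vanishing of the 2 x 2 minors
   through it. *)
apply: A_min; exists (col j A), ((A i j)^-1 *: row i A)^T.
split=> [p q|p q|]; rewrite ?mxE //.
  by rewrite mulr_ge0 ?invr_ge0 ?A_ge0.
apply/matrixP => p q; rewrite !mxE big_ord1 !mxE mulrCA.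
by rewrite -(mxrank1_minor i j) // mulrC mulfK ?gt_eqF.
Qed.

Lemma nonneg_rank_tens_le m1 n1 m2 n2 (A : 'M[R]_(m1, n1))
  (B : 'M[R]_(m2, n2)) : nonneg_mx A -> nonneg_mx B ->
  (nonneg_rank (A *t B) <= nonneg_rank A * nonneg_rank B)%N.
Proof.
move=> A_ge0 B_ge0.
apply: (nonneg_rankP (nonneg_mx_tens A_ge0 B_ge0)).2.
exact: nonneg_factorable_tens (nonneg_rankP A_ge0).1 (nonneg_rankP B_ge0).1.
Qed.

Lemma nonneg_rank_le_scale_mxsub m n p q (c : R) (f : 'I_p -> 'I_m)
  (g : 'I_q -> 'I_n) (A : 'M[R]_(m, n)) (B : 'M[R]_(p, q)) :
  nonneg_mx A -> nonneg_mx B -> 0 < c -> mxsub f g A = c *: B ->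
  (nonneg_rank B <= nonneg_rank A)%N.
Proof.
move=> A_ge0 B_ge0 c_gt0 AB; apply: (nonneg_rankP B_ge0).2.
have -> : B = c^-1 *: mxsub f g A.
  by rewrite AB scalerA mulVf ?scale1r ?gt_eqF.
apply: nonneg_factorable_scale; first by rewrite invr_ge0 ltW.
exact: nonneg_factorable_mxsub (nonneg_rankP A_ge0).1.
Qed.

Lemma nonneg_rank_tensr m1 n1 m2 n2 (A : 'M[R]_(m1, n1))
  (B : 'M[R]_(m2, n2)) : nonneg_mx A -> nonneg_mx B -> A != 0 ->
  (nonneg_rank B <= nonneg_rank (A *t B))%N.
Proof.
move=> A_ge0 B_ge0 /(nonneg_mx_neq0 A_ge0)[i [j Aij_gt0]].
(* Fixing the first components of the index pairs at [i] and [j] selects the block [A i j *: B]. *)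
apply: (@nonneg_rank_le_scale_mxsub _ _ _ _ (A i j)
  (fun p => mxtens_index (i, p)) (fun q => mxtens_index (j, q))) => //.
  exact: nonneg_mx_tens.
by apply/matrixP => p q; rewrite !mxE !mxtens_indexK.
Qed.

Lemma nonneg_rank_tensl m1 n1 m2 n2 (A : 'M[R]_(m1, n1))
  (B : 'M[R]_(m2, n2)) : nonneg_mx A -> nonneg_mx B -> B != 0 ->
  (nonneg_rank A <= nonneg_rank (A *t B))%N.
Proof.
move=> A_ge0 B_ge0 /(nonneg_mx_neq0 B_ge0)[i [j Bij_gt0]].
(* Fixing the second components instead picks one entry from each block, which gives
   [B i j *: A]. *)
apply: (@nonneg_rank_le_scale_mxsub _ _ _ _ (B i j)
  (fun p => mxtens_index (p, i)) (fun q => mxtens_index (q, j))) => //.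
  exact: nonneg_mx_tens.
by apply/matrixP => p q; rewrite !mxE !mxtens_indexK mulrC.
Qed.

End NonnegRank.

Theorem theorem1p3 (R : realType) (m1 n1 m2 n2 : nat)
    (A1 : 'M[R]_(m1, n1)) (A2 : 'M[R]_(m2, n2))
    (A1_ge0 : nonneg_mx A1) (A2_ge0 : nonneg_mx A2)
    (rank1 : \rank A1 = 1%N \/ \rank A2 = 1%N) :
  nonneg_rank (A1 *t A2) = (nonneg_rank A1 * nonneg_rank A2)%N.
Proof.
apply/eqP; rewrite eqn_leq nonneg_rank_tens_le //=.
(* The product of ranks reduces to the nonnegative rank of the other factor; the factor of rank 1 is
   nonzero, so the submatrix bound applies. *)
case: rank1 => A_rank1; rewrite (nonneg_rank_rank1 _ A_rank1) //.
- by rewrite mul1n nonneg_rank_tensr // -mxrank_eq0 A_rank1.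
- by rewrite muln1 nonneg_rank_tensl // -mxrank_eq0 A_rank1.
Qed.
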